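(* Let $X$ be a set with $|X|\geq 2$ and let $\mathcal{B} \subset \mathrm{Br}(X)$ be a length-compatible Hall set. For every $a < b \in \mathcal{B}$, $$\| [a, b] \|_{\mathcal{B}} \leq 2^{|b|-1}.$$
   Context: The base field is $\mathbb{K}=\mathbb{R}$ or $\mathbb{C}$; $X$ is a set (possibly infinite) with at least two elements. $\mathrm{Br}(X)$ is the free magma over $X$: the set of formal binary brackets (rooted planar binary trees with leaves labelled by elements of $X$), with product $(t_1,t_2)$. For $t\in \mathrm{Br}(X)$, $|t|$ is its number of leaves; if $t\notin X$, $t$ is written uniquely as $t=(\lambda(t),\mu(t))$. $\mathcal{L}(X)$ is the free Lie algebra over $X$ and $\mathrm{ev}:\mathrm{Br}(X)\to\mathcal{L}(X)$ is the canonical evaluation ($\mathrm{ev}(x)=x$ for $x\in X$, $\mathrm{ev}((t_1,t_2))=[\mathrm{ev}(t_1),\mathrm{ev}(t_2)]$). For $a,b\in\mathrm{Br}(X)$, $[a,b]$ denotes $[\mathrm{ev}(a),\mathrm{ev}(b)]\in\mathcal{L}(X)$. A Hall set is a subset $\mathcal{B}\subset\mathrm{Br}(X)$ endowed with a total order $<$ such that: (i) $X\subset\mathcal{B}$; (ii) for all $b_1,b_2\in\mathrm{Br}(X)$, $(b_1,b_2)\in\mathcal{B}$ iff $b_1,b_2\in\mathcal{B}$, $b_1<b_2$ and either $b_2\in X$ or $\lambda(b_2)\leq b_1$; (iii) for all $b_1,b_2\in\mathcal{B}$ with $(b_1,b_2)\in\mathcal{B}$, $b_1<(b_1,b_2)$.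 By a theorem of Viennot, $\mathrm{ev}$ is injective on $\mathcal{B}$ and $\mathrm{ev}(\mathcal{B})$ is a basis of $\mathcal{L}(X)$. For $u=\sum_{c\in\mathcal{B}}\alpha_c\,\mathrm{ev}(c)\in\mathcal{L}(X)$ (finite sum), $\|u\|_{\mathcal{B}}:=\sum_{c}|\alpha_c|$. A Hall set $\mathcal{B}$ is length-compatible when for all $a,b\in\mathcal{B}$, $a<b$ implies $|a|\leq|b|$. *)

(* Defs.v *)
From HB Require Import structures.
From mathcomp Require Import all_boot all_order all_algebra.
From mathcomp Require Import finmap.
From mathcomp Require Import boolp classical_sets reals.
From mathcomp Require Export complex.

Set Implicit Arguments.
Unset Strict Implicit.
Unset Printing Implicit Defensive.
Import Order.TTheory GRing.Theory Num.Theory.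
Local Open Scope ring_scope.
Local Open Scope quotient_scope.

Inductive real_or_complex (R : realType) : numFieldType -> Prop :=
| base_real : real_or_complex R R
| base_complex : real_or_complex R R[i].

Inductive Br (X : Type) : Type :=
| Leaf of X
| Node of Br X & Br X.

(* X is an arbitrary set: equality and choice on Br X are classical. *)
HB.instance Definition _ (X : Type) := gen_eqMixin (Br X).
HB.instance Definition _ (X : Type) := gen_choiceMixin (Br X).

Fixpoint leaves (X : Type) (t : Br X) : nat :=
  if t is Node t1 t2 then (leaves t1 + leaves t2)%N else 1%N.

Definition is_leaf (X : Type) (t : Br X) : Prop := exists x, t = Leaf x.

(* The value on leaves is junk. *)
Definition lambda (X : Type) (t : Br X) : Br X :=
  if t is Node l _ then l else t.

HB.mixin Record isLieAlgebra (K : comNzRingType) L of GRing.Lmodule K L := {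
  lie : L -> L -> L;
  lieDl : forall u v w, lie (u + v) w = lie u w + lie v w;
  lieDr : forall u v w, lie u (v + w) = lie u v + lie u w;
  lieZl : forall (k : K) u v, lie (k *: u) v = k *: lie u v;
  lieZr : forall (k : K) u v, lie u (k *: v) = k *: lie u v;
  liexx : forall u, lie u u = 0;
  lie_jacobi : forall u v w,
    lie u (lie v w) + lie v (lie w u) + lie w (lie u v) = 0
}.

#[short(type="lieAlgType")]
HB.structure Definition LieAlgebra (K : comNzRingType) :=
  {L of isLieAlgebra K L & GRing.Lmodule K L}.

(* The free Lie algebra: formal Lie expressions over X modulo the least
   congruence containing the axioms of a Lie algebra over K. *)
Inductive lie_expr (K : comNzRingType) (X : Type) : Type :=
| Evar of X
| Ezero
| Eopp of lie_expr K X
| Eadd of lie_expr K X & lie_expr K X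
| Escale of K & lie_expr K X
| Ebr of lie_expr K X & lie_expr K X.
Arguments Evar {K X}.
Arguments Ezero {K X}.

HB.instance Definition _ (K : comNzRingType) (X : Type) :=
  gen_eqMixin (lie_expr K X).
HB.instance Definition _ (K : comNzRingType) (X : Type) :=
  gen_choiceMixin (lie_expr K X).

Inductive lie_cong (K : comNzRingType) (X : Type) :
    lie_expr K X -> lie_expr K X -> Prop :=
| cong_refl e : lie_cong e e
| cong_sym e f : lie_cong e f -> lie_cong f e
| cong_trans f e g : lie_cong e f -> lie_cong f g -> lie_cong e g
| cong_opp e f : lie_cong e f -> lie_cong (Eopp e) (Eopp f)
| cong_add e e' f f' :
    lie_cong e e' -> lie_cong f f' -> lie_cong (Eadd e f) (Eadd e' f')
| cong_scale k e f : lie_cong e f -> lie_cong (Escale k e) (Escale k f)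
| cong_br e e' f f' :
    lie_cong e e' -> lie_cong f f' -> lie_cong (Ebr e f) (Ebr e' f')
| cong_addA e f g : lie_cong (Eadd e (Eadd f g)) (Eadd (Eadd e f) g)
| cong_addC e f : lie_cong (Eadd e f) (Eadd f e)
| cong_add0 e : lie_cong (Eadd Ezero e) e
| cong_addN e : lie_cong (Eadd (Eopp e) e) Ezero
| cong_scaleA k l e : lie_cong (Escale k (Escale l e)) (Escale (k * l) e)
| cong_scale1 e : lie_cong (Escale 1 e) e
| cong_scaleDr k e f :
    lie_cong (Escale k (Eadd e f)) (Eadd (Escale k e) (Escale k f))
| cong_scaleDl k l e :
    lie_cong (Escale (k + l) e) (Eadd (Escale k e) (Escale l e))
| cong_brDl e f g : lie_cong (Ebr (Eadd e f) g) (Eadd (Ebr e g) (Ebr f g))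
| cong_brDr e f g : lie_cong (Ebr e (Eadd f g)) (Eadd (Ebr e f) (Ebr e g))
| cong_brZl k e f : lie_cong (Ebr (Escale k e) f) (Escale k (Ebr e f))
| cong_brZr k e f : lie_cong (Ebr e (Escale k f)) (Escale k (Ebr e f))
| cong_brxx e : lie_cong (Ebr e e) Ezero
| cong_jacobi e f g :
    lie_cong
      (Eadd (Eadd (Ebr e (Ebr f g)) (Ebr f (Ebr g e))) (Ebr g (Ebr e f)))
      Ezero.

Section FreeLie.
Variables (K : comNzRingType) (X : Type).

Definition lie_congb (e f : lie_expr K X) : bool := `[< lie_cong e f >].

Fact lie_congb_equiv : equiv_class_of lie_congb.
Proof.
split=> [e|e f|f e g]; first by apply/asboolP/cong_refl.
- by apply/asboolP/asboolP => /cong_sym.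
- by move=> /asboolP h1 /asboolP h2; apply/asboolP/(cong_trans h1 h2).
Qed.
Canonical lie_cong_rel := EquivRelPack lie_congb_equiv.

Definition free_lie := {eq_quot lie_cong_rel}.
HB.instance Definition _ := Choice.on free_lie.

Definition lie_class (e : lie_expr K X) : free_lie := \pi_free_lie e.
Definition lie_rep (u : free_lie) : lie_expr K X := repr u.

Lemma lie_classP (e f : lie_expr K X) :
  lie_class e = lie_class f <-> lie_cong e f.
Proof.
by split=> [/eqmodP/asboolP|h]; last by apply/eqmodP/asboolP.
Qed.

Lemma lie_repK : cancel lie_rep lie_class.
Proof. exact: reprK. Qed.

Lemma lie_classK (e : lie_expr K X) : lie_cong (lie_rep (lie_class e)) e.
Proof. by apply/lie_classP; rewrite lie_repK. Qed.

Definition free_zero : free_lie := lie_class Ezero.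
Definition free_opp (u : free_lie) : free_lie := lie_class (Eopp (lie_rep u)).
Definition free_add (u v : free_lie) : free_lie :=
  lie_class (Eadd (lie_rep u) (lie_rep v)).
Definition free_scale (k : K) (u : free_lie) : free_lie :=
  lie_class (Escale k (lie_rep u)).
Definition free_br (u v : free_lie) : free_lie :=
  lie_class (Ebr (lie_rep u) (lie_rep v)).

Lemma free_oppE e : free_opp (lie_class e) = lie_class (Eopp e).
Proof. exact/lie_classP/cong_opp/lie_classK. Qed.
Lemma free_addE e f :
  free_add (lie_class e) (lie_class f) = lie_class (Eadd e f).
Proof. by apply/lie_classP/cong_add; exact: lie_classK. Qed.
Lemma free_scaleE k e : free_scale k (lie_class e) = lie_class (Escale k e).
Proof. exact/lie_classP/cong_scale/lie_classK. Qed.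
Lemma free_brE e f : free_br (lie_class e) (lie_class f) = lie_class (Ebr e f).
Proof. by apply/lie_classP/cong_br; exact: lie_classK. Qed.

Let freeE := (free_oppE, free_addE, free_scaleE, free_brE).

Lemma free_addA : associative free_add.
Proof.
move=> u v w; rewrite -(lie_repK u) -(lie_repK v) -(lie_repK w) !freeE.
exact/lie_classP/cong_addA.
Qed.
Lemma free_addC : commutative free_add.
Proof.
move=> u v; rewrite -(lie_repK u) -(lie_repK v) !freeE.
exact/lie_classP/cong_addC.
Qed.
Lemma free_add0 : left_id free_zero free_add.
Proof. by move=> u; rewrite -(lie_repK u) freeE; apply/lie_classP/cong_add0. Qed.
Lemma free_addN : left_inverse free_zero free_opp free_add.
Proof. by move=> u; rewrite -(lie_repK u) !freeE; apply/lie_classP/cong_addN. Qed.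

HB.instance Definition _ :=
  GRing.isZmodule.Build free_lie free_addA free_addC free_add0 free_addN.

Lemma free_scaleA k l u : free_scale k (free_scale l u) = free_scale (k * l) u.
Proof. by rewrite -(lie_repK u) !freeE; apply/lie_classP/cong_scaleA. Qed.
Lemma free_scale1 : left_id 1 free_scale.
Proof. by move=> u; rewrite -(lie_repK u) freeE; apply/lie_classP/cong_scale1. Qed.
Lemma free_scaleDr : right_distributive free_scale +%R.
Proof.
move=> k u v; rewrite /GRing.add /= -(lie_repK u) -(lie_repK v) !freeE.
exact/lie_classP/cong_scaleDr.
Qed.
Lemma free_scaleDl u : {morph free_scale^~ u : k l / k + l}.
Proof.
move=> k l /=; rewrite [RHS]/GRing.add /= -(lie_repK u) !freeE.
exact/lie_classP/cong_scaleDl.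
Qed.

HB.instance Definition _ := GRing.Zmodule_isLmodule.Build K free_lie
  free_scaleA free_scale1 free_scaleDr free_scaleDl.

Lemma lie_class0 : lie_class Ezero = 0. Proof. by []. Qed.
Lemma lie_classN e : lie_class (Eopp e) = - lie_class e.
Proof. by rewrite -free_oppE. Qed.
Lemma lie_classD e f : lie_class (Eadd e f) = lie_class e + lie_class f.
Proof. by rewrite -free_addE. Qed.
Lemma lie_classZ k e : lie_class (Escale k e) = k *: lie_class e.
Proof. by rewrite -free_scaleE. Qed.

Lemma free_brDl u v w : free_br (u + v) w = free_br u w + free_br v w.
Proof.
rewrite -(lie_repK u) -(lie_repK v) -(lie_repK w) -lie_classD !free_brE.
by rewrite -lie_classD; apply/lie_classP/cong_brDl.
Qed.
Lemma free_brDr u v w : free_br u (v + w) = free_br u v + free_br u w.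
Proof.
rewrite -(lie_repK u) -(lie_repK v) -(lie_repK w) -lie_classD !free_brE.
by rewrite -lie_classD; apply/lie_classP/cong_brDr.
Qed.
Lemma free_brZl k u v : free_br (k *: u) v = k *: free_br u v.
Proof.
rewrite -(lie_repK u) -(lie_repK v) -lie_classZ !free_brE -lie_classZ.
exact/lie_classP/cong_brZl.
Qed.
Lemma free_brZr k u v : free_br u (k *: v) = k *: free_br u v.
Proof.
rewrite -(lie_repK u) -(lie_repK v) -lie_classZ !free_brE -lie_classZ.
exact/lie_classP/cong_brZr.
Qed.
Lemma free_brxx u : free_br u u = 0.
Proof. by rewrite -(lie_repK u) free_brE; apply/lie_classP/cong_brxx. Qed.
Lemma free_jacobi u v w :
  free_br u (free_br v w) + free_br v (free_br w u) + free_br w (free_br u v)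
  = 0.
Proof.
rewrite -(lie_repK u) -(lie_repK v) -(lie_repK w) !free_brE -!lie_classD.
exact/lie_classP/cong_jacobi.
Qed.

HB.instance Definition _ := isLieAlgebra.Build K free_lie
  free_brDl free_brDr free_brZl free_brZr free_brxx free_jacobi.

Lemma lie_class_br e f : lie_class (Ebr e f) = lie (lie_class e) (lie_class f).
Proof. by rewrite /lie /= -free_brE. Qed.

Definition free_gen (x : X) : free_lie := lie_class (Evar x).

Fixpoint ev (t : Br X) : free_lie :=
  match t with
  | Leaf x => free_gen x
  | Node t1 t2 => lie (ev t1) (ev t2)
  end.

Fixpoint lie_eval (L : lieAlgType K) (f : X -> L) (e : lie_expr K X) : L :=
  match e with
  | Evar x => f x
  | Ezero => 0
  | Eopp e => - lie_eval f e
  | Eadd e1 e2 => lie_eval f e1 + lie_eval f e2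
  | Escale k e => k *: lie_eval f e
  | Ebr e1 e2 => lie (lie_eval f e1) (lie_eval f e2)
  end.

Lemma lie_eval_cong (L : lieAlgType K) (f : X -> L) e1 e2 :
  lie_cong e1 e2 -> lie_eval f e1 = lie_eval f e2.
Proof.
elim=> /=; try by move=> *; congruence.
- by move=> *; rewrite addrA.
- by move=> *; rewrite addrC.
- by move=> *; rewrite add0r.
- by move=> *; rewrite addNr.
- by move=> *; rewrite scalerA.
- by move=> *; rewrite scale1r.
- by move=> *; rewrite scalerDr.
- by move=> *; rewrite scalerDl.
- by move=> *; rewrite lieDl.
- by move=> *; rewrite lieDr.
- by move=> *; rewrite lieZl.
- by move=> *; rewrite lieZr.
- by move=> *; rewrite liexx.
- by move=> *; rewrite lie_jacobi.
Qed.

Definition lie_morphism (L M : lieAlgType K) (g : L -> M) : Prop :=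
  linear g /\ forall u v, g (lie u v) = lie (g u) (g v).

Theorem free_lie_universal (L : lieAlgType K) (f : X -> L) :
  exists! g : free_lie -> L,
    lie_morphism g /\ forall x, g (free_gen x) = f x.
Proof.
pose g u := lie_eval f (lie_rep u).
have gE e : g (lie_class e) = lie_eval f e.
  exact/lie_eval_cong/lie_classK.
exists g; split=> [|h [[hl hb] hx]].
  split=> [|x]; last by rewrite gE.
  split=> [k u v|u v]; rewrite -(lie_repK u) -(lie_repK v).
    by rewrite -lie_classZ -lie_classD !gE.
  by rewrite -lie_class_br !gE.
have hD u v : h (u + v) = h u + h v by have := hl 1 u v; rewrite !scale1r.
have h0 : h 0 = 0 by apply: (addrI (h 0)); rewrite -hD !addr0.
have hZ k u : h (k *: u) = k *: h u by rewrite -[k *: u]addr0 hl h0 addr0.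
apply/funext => u; rewrite -(lie_repK u) gE; elim: (lie_rep u) => /=.
- by move=> x; rewrite -hx.
- by rewrite lie_class0 h0.
- by move=> e ->; rewrite lie_classN -scaleN1r -(scaleN1r (lie_class e)) hZ.
- by move=> e1 -> e2 ->; rewrite lie_classD hD.
- by move=> k e ->; rewrite lie_classZ hZ.
- by move=> e1 -> e2 ->; rewrite lie_class_br hb.
Qed.

End FreeLie.
Arguments free_gen K {X} x.
Arguments ev K {X} t.

Section Hall.
Variable X : Type.

(* Only the restriction of lt to B is relevant. *)
Definition strict_total_order_on (B : set (Br X)) (lt : Br X -> Br X -> Prop) :=
  [/\ forall a, B a -> ~ lt a a,
      forall a b c, B a -> B b -> B c -> lt a b -> lt b c -> lt a c
    & forall a b, B a -> B b -> a <> b -> lt a b \/ lt b a].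

Definition hall_set (B : set (Br X)) (lt : Br X -> Br X -> Prop) : Prop :=
  [/\ strict_total_order_on B lt,
      forall x, B (Leaf x),
      forall b1 b2, B (Node b1 b2) <->
        [/\ B b1, B b2, lt b1 b2
          & is_leaf b2 \/ (lt (lambda b2) b1 \/ lambda b2 = b1)]
    & forall b1 b2, B b1 -> B b2 -> B (Node b1 b2) -> lt b1 (Node b1 b2)].

Definition length_compatible (B : set (Br X)) (lt : Br X -> Br X -> Prop) :=
  forall a b, B a -> B b -> lt a b -> (leaves a <= leaves b)%N.

End Hall.

Section HallNorm.
Variables (K : numFieldType) (X : Type) (B : set (Br X)).

Definition hall_decomposition (u : free_lie K X)
    (alpha : {fsfun Br X -> K with 0}) : Prop :=
  (forall c, c \in finsupp alpha -> B c) /\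
  u = \sum_(c <- finsupp alpha) alpha c *: ev K c.

(* When B is a Hall set, Viennot's theorem says that every u has exactly one
   decomposition, so that the choice made by xget is immaterial. *)
Definition hall_coord (u : free_lie K X) : {fsfun Br X -> K with 0} :=
  xget [fsfun] [set alpha | hall_decomposition u alpha].

Definition hall_norm (u : free_lie K X) : K :=
  \sum_(c <- finsupp (hall_coord u)) `|hall_coord u c|.

End HallNorm.

(* Main.v *)
(** Two facts are combined.

    Uniqueness of decompositions. The trees of a Hall set are linearly
    independent in the free Lie algebra, by Lazard elimination: in a finite
    family of Hall trees the least letter a is smaller than every tree on the
    letters that occur, and the maximal subtrees (a, (a, ... (a, y))) may be
    taken as new letters (k, y). This gives again a Hall family with fewer
    leaves, and the free Lie algebra maps to the semidirect product of K a and
    the free Lie algebra over the letters (k, y).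

    The bound. For p < b = (l, r) with p < l, Leibniz gives
    [p, (l, r)] = [[p, l], r] + [l, [p, r]]. Length-compatibility forces every
    Hall tree c occurring in [p, l] to satisfy l < c and lambda c <= l, so that
    [c, r] is up to sign zero or a Hall tree. Carrying along the outer left
    factors l1 <= ... <= lk, each of which at most doubles the number of terms
    of [c, r], one gets by induction on b that [lk, ... [l1, [p, b]]] has norm
    at most 2^k (2^(|b|-1) - 1) + 1. *)

From HB Require Import structures.
Require Import Defs.
From mathcomp Require Import all_boot all_order all_algebra zify.
From mathcomp Require Import finmap.
From mathcomp Require Import boolp classical_sets reals.
Import Order.TTheory GRing.Theory Num.Theory.
Local Open Scope ring_scope.

Set Implicit Arguments.
Unset Strict Implicit.
Unset Printing Implicit Defensive.

(** * Sign rules and the Leibniz form of the Jacobi identity *)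

Section LieIdentities.
Variables (K : comNzRingType) (L : lieAlgType K).
Implicit Types u v w : L.

Lemma lie0l u : lie 0 u = 0.
Proof. by rewrite -[X in lie X u](scale0r u) lieZl scale0r. Qed.

Lemma lieNl u v : lie (- u) v = - lie u v.
Proof. by rewrite -scaleN1r lieZl scaleN1r. Qed.

Lemma lieNr u v : lie u (- v) = - lie u v.
Proof. by rewrite -scaleN1r lieZr scaleN1r. Qed.

Lemma lieC u v : lie u v = - lie v u.
Proof.
apply/eqP; rewrite -addr_eq0 -(liexx (u + v)) lieDl !lieDr !liexx.
by rewrite add0r addr0.
Qed.

Lemma lie_leibniz u v w : lie u (lie v w) = lie (lie u v) w + lie v (lie u w).
Proof.
rewrite (lieC (lie u v)) (lieC u w) lieNr -opprD; apply/eqP.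
by rewrite -addr_eq0 (addrC (lie w _)) addrA lie_jacobi.
Qed.

End LieIdentities.

(** * Derivations of the free Lie algebra with prescribed values on the letters *)

Section Derivation.
Variables (K : comNzRingType) (X : Type) (f : X -> free_lie K X).

Fixpoint der_expr (e : lie_expr K X) : free_lie K X :=
  match e with
  | Evar x => f x
  | Ezero => 0
  | Eopp e => - der_expr e
  | Eadd e1 e2 => der_expr e1 + der_expr e2
  | Escale k e => k *: der_expr e
  | Ebr e1 e2 =>
    lie (der_expr e1) (lie_class e2) + lie (lie_class e1) (der_expr e2)
  end.

Lemma der_expr_cong e1 e2 : lie_cong e1 e2 -> der_expr e1 = der_expr e2.
Proof.
elim=> /=; try by move=> *; congruence.
- move=> {}e1 e1' f1 f1' /lie_classP h1 d1 /lie_classP h2 d2.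
  by rewrite d1 d2 h1 h2.
- by move=> *; rewrite addrA.
- by move=> *; rewrite addrC.
- by move=> *; rewrite add0r.
- by move=> *; rewrite addNr.
- by move=> *; rewrite scalerA.
- by move=> *; rewrite scale1r.
- by move=> *; rewrite scalerDr.
- by move=> *; rewrite scalerDl.
- by move=> *; rewrite lie_classD !lieDl addrACA.
- by move=> *; rewrite lie_classD !lieDr addrACA.
- by move=> *; rewrite lie_classZ !lieZl scalerDr.
- by move=> *; rewrite lie_classZ !lieZr scalerDr.
- by move=> e; rewrite lieC addNr.
- move=> e g h; rewrite !lie_class_br !lieDr !addrA.
  set E := lie_class e; set G := lie_class g; set H := lie_class h.
  set e' := der_expr e; set g' := der_expr g; set h' := der_expr h.
  (* The nine terms form three Jacobi sums, one for each argument that is derived. *)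
  rewrite [LHS](ACl ((1*6*8)*(2*4*9)*(3*5*7))) /=.
  by rewrite !lie_jacobi !addr0.
Qed.

Definition der (u : free_lie K X) : free_lie K X := der_expr (lie_rep u).

Lemma der_class e : der (lie_class e) = der_expr e.
Proof. exact/der_expr_cong/lie_classK. Qed.

Lemma der_gen x : der (free_gen K x) = f x.
Proof. exact: der_class. Qed.

Lemma der_linear : linear der.
Proof.
move=> k u v; rewrite -(lie_repK u) -(lie_repK v) -lie_classZ -lie_classD.
by rewrite !der_class.
Qed.

Lemma der_lie u v : der (lie u v) = lie (der u) v + lie u (der v).
Proof.
by rewrite -(lie_repK u) -(lie_repK v) -lie_class_br !der_class.
Qed.

End Derivation.

(** * Semidirect product of a line with a Lie algebra along a derivation *)

Section Semidirect.
Variables (K : comNzRingType) (L : lieAlgType K) (D : L -> L).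
Hypothesis (Dlin : linear D).
Hypothesis (Dlie : forall u v, D (lie u v) = lie (D u) v + lie u (D v)).

(** The proofs about [D] are arguments of the type because the Lie structure put on it depends on
    them. *)
Definition semidirect & linear D
  & (forall u v, D (lie u v) = lie (D u) v + lie u (D v)) : Type :=
  (K^o * L)%type.
Local Notation S := (semidirect Dlin Dlie).
HB.instance Definition _ := GRing.Lmodule.on S.

(** With [(s, u)] read as $s d + u$, where $[d, u] = D u$, this is the bracket of $s d + u$ and $t d
    + v$. *)
Definition semidirect_lie (p q : S) : S :=
  (0, lie p.2 q.2 + ((p.1 : K) *: D q.2 - (q.1 : K) *: D p.2)).

Let DD u v : D (u + v) = D u + D v.
Proof. by have := Dlin 1 u v; rewrite !scale1r. Qed.
Let D0 : D 0 = 0.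
Proof. by apply: (addrI (D 0)); rewrite -DD !addr0. Qed.
Let DZ k u : D (k *: u) = k *: D u.
Proof. by rewrite -[k *: u]addr0 Dlin D0 addr0. Qed.
Let DN u : D (- u) = - D u.
Proof. by rewrite -scaleN1r DZ scaleN1r. Qed.

Lemma semidirect_lieC p q : semidirect_lie p q = - semidirect_lie q p.
Proof.
apply/eqP; rewrite xpair_eqE oppr0 eqxx /=.
by rewrite lieC !opprD opprK (addrC (_ *: _)).
Qed.

Lemma semidirect_lieDr p q r :
  semidirect_lie p (q + r) = semidirect_lie p q + semidirect_lie p r.
Proof.
apply/eqP; rewrite xpair_eqE addr0 eqxx /=.
rewrite lieDr DD scalerDr scalerDl opprD.
by rewrite [eqbRHS]addrACA; apply/eqP; congr (_ + _); rewrite addrACA.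
Qed.

Lemma semidirect_lieZr k p q :
  semidirect_lie p (k *: q) = k *: semidirect_lie p q.
Proof.
apply/eqP; rewrite xpair_eqE scaler0 eqxx /=.
by rewrite lieZr DZ !scalerDr scalerN !scalerA (mulrC p.1).
Qed.

Lemma semidirect_lieDl p q r :
  semidirect_lie (p + q) r = semidirect_lie p r + semidirect_lie q r.
Proof. by rewrite !(semidirect_lieC _ r) semidirect_lieDr opprD. Qed.

Lemma semidirect_lieZl k p q :
  semidirect_lie (k *: p) q = k *: semidirect_lie p q.
Proof. by rewrite !(semidirect_lieC _ q) semidirect_lieZr scalerN. Qed.

Lemma semidirect_liexx p : semidirect_lie p p = 0.
Proof. by apply/eqP; rewrite xpair_eqE eqxx /= liexx subrr addr0. Qed.

Lemma semidirect_jacobi p q r :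
  semidirect_lie p (semidirect_lie q r) + semidirect_lie q (semidirect_lie r p)
  + semidirect_lie r (semidirect_lie p q) = 0.
Proof.
case: p q r => [s u] [t v] [k w]; apply/eqP.
rewrite xpair_eqE /= !addr0 eqxx /= !scale0r !subr0; apply/eqP.
rewrite !(DD, DN, DZ, Dlie, lieDr, lieNr, lieZr, scalerDr, scalerN, scalerA).
rewrite (lieC (D v)) (lieC (D w)) (lieC (D u)) !scalerN !addrA.
(* Of the 21 terms, three form the Jacobi sum of [u], [v], [w] and the others cancel in nine
   pairs. *)
rewrite (mulrC t s) (mulrC k s) (mulrC k t) [LHS](ACl ((1*8*15)
  *(2*11)*(19*3)*(16*4)*(5*10)*(6*14)*(20*7)*(9*18)*(12*17)*(13*21))) /=.
by rewrite lie_jacobi !subrr !addr0.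
Qed.

HB.instance Definition _ := isLieAlgebra.Build K S
  semidirect_lieDl semidirect_lieDr semidirect_lieZl semidirect_lieZr
  semidirect_liexx semidirect_jacobi.

Lemma semidirectE (p q : S) :
  lie p q = (0, lie p.2 q.2 + ((p.1 : K) *: D q.2 - (q.1 : K) *: D p.2)).
Proof. by []. Qed.

End Semidirect.

(** * Hall-like families and their least letter *)

Lemma strict_total_min (X : Type) (B : set (Br X)) lt (s : seq (Br X)) :
    strict_total_order_on B lt -> s <> [::] -> (forall x, x \in s -> B x) ->
  exists2 m, m \in s & forall x, x \in s -> x = m \/ lt m x.
Proof.
move=> [irr tr tot]; elim: s => // y s IH _ sB.
have [->|/eqP s0] := eqVneq s [::].
  by exists y; rewrite ?mem_head // => x; rewrite inE => /eqP; left.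
have By : B y by apply: sB; rewrite mem_head.
have {}sB x : x \in s -> B x by move=> xs; apply: sB; rewrite inE xs orbT.
have [m ms mmin] := IH s0 sB; have Bm := sB m ms.
have [ym|ym] := pselect (lt y m).
  exists y; first by rewrite mem_head.
  move=> x; rewrite inE => /orP[/eqP|xs]; first by left.
  right; case: (mmin x xs) => [->//|mx].
  by apply: (tr _ m) => //; exact: sB.
exists m; first by rewrite inE ms orbT.
move=> x; rewrite inE => /orP[/eqP ->|]; last exact: mmin.
have [->|/eqP/(tot _ _ By Bm)[]//] := eqVneq y m; [by left|by right].
Qed.

Section HallLike.
Variable X : Type.
Implicit Types (B : set (Br X)) (lt : Br X -> Br X -> Prop) (b t : Br X).

(* The conditions on a Hall set that survive restriction to the trees over a
   subset of the letters, and hence Lazard elimination. *)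
Definition hall_like B lt :=
  strict_total_order_on B lt /\
  forall b1 b2, B (Node b1 b2) ->
    [/\ B b1, B b2, lt b1 b2,
        is_leaf b2 \/ (lt (lambda b2) b1 \/ lambda b2 = b1)
      & lt b1 (Node b1 b2)].

Lemma hall_set_like B lt : hall_set B lt -> hall_like B lt.
Proof.
move=> [ord _ hN hlt]; split=> // b1 b2 Bb.
by have [Bb1 Bb2 lt12 hl] := (hN b1 b2).1 Bb; split=> //; exact: hlt.
Qed.

Lemma hall_like_lambda B lt b : hall_like B lt -> B b -> B (lambda b).
Proof. by case: b => //= b1 b2 [_ hN] /hN[]. Qed.

Fixpoint fringe t : seq (Br X) :=
  if t is Node t1 t2 then fringe t1 ++ fringe t2 else [:: t].

Lemma fringe_leaf t u : u \in fringe t -> is_leaf u.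
Proof.
elim: t => [x|t1 IH1 t2 IH2] /=; first by rewrite inE => /eqP ->; exists x.
by rewrite mem_cat => /orP[/IH1|/IH2].
Qed.

Lemma fringe_hall B lt b u : hall_like B lt -> B b -> u \in fringe b -> B u.
Proof.
move=> hB; elim: b => [x|b1 IH1 b2 IH2] /=; first by rewrite inE => ? /eqP ->.
by move=> /hB.2[? ? _ _ _]; rewrite mem_cat => /orP[/IH1|/IH2]; exact.
Qed.

Lemma size_fringe t : size (fringe t) = leaves t.
Proof. by elim: t => //= t1 IH1 t2 IH2; rewrite size_cat IH1 IH2. Qed.

Lemma leaves_gt0 t : (0 < leaves t)%N.
Proof. by elim: t => //= t1 h1 t2 h2; rewrite addn_gt0 h1. Qed.

Definition above B lt a : set (Br X) :=
  [set b | B b /\ forall u, u \in fringe b -> u = a \/ lt a u].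

Lemma above_hall_like B lt a : hall_like B lt -> hall_like (above B lt a) lt.
Proof.
move=> [[irr tr tot] hN]; split.
  split=> [b [Bb _]|b c d [Bb _] [Bc _] [Bd _]|b c [Bb _] [Bc _]].
  - exact: irr.
  - exact: tr.
  - exact: tot.
move=> b1 b2 [/hN[Bb1 Bb2 lt12 hl hlt] hf]; split=> //; split=> // u fu;
  by apply: hf; rewrite /= mem_cat fu ?orbT.
Qed.

(** A node lies above its left child, so the claim descends along left children to a letter. *)
Lemma above_min B lt a b : hall_like B lt -> B a ->
  above B lt a b -> b = a \/ lt a b.
Proof.
move=> [[_ tr _] hN] Ba; elim: b => [x|b1 IH1 b2 _] [Bb hf].
  by apply: hf; rewrite /= mem_head.
have [Bb1 _ _ _ ltb] := hN _ _ Bb; right.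
case: IH1 => [|<-//|ab1].
  by split=> // u fu; apply: hf; rewrite /= mem_cat fu.
exact: (tr _ b1).
Qed.

End HallLike.

(** * Lazard elimination of the least letter *)

Section Elimination.
Variables (X : Type) (B : set (Br X)) (lt : Br X -> Br X -> Prop) (x0 : X).
Local Notation a := (Leaf x0).
Hypothesis (hB : hall_like B lt) (Ba : B a).
Hypothesis (a_min : forall b, B b -> b = a \/ lt a b).

(* The letter (k, y) stands for the tree (a, (a, ... (a, y))) with k copies
   of the eliminated letter a. *)
Fixpoint elim_tree (t : Br X) : Br (nat * X) :=
  match t with
  | Leaf x => Leaf (0%N, x)
  | Node t1 t2 =>
    match t1 == a, elim_tree t2 with
    | true, Leaf (k, y) => Leaf (k.+1, y)
    | _, s2 => Node (elim_tree t1) s2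
    end
  end.

Fixpoint unelim_tree (s : Br (nat * X)) : Br X :=
  match s with
  | Leaf (k, y) => iter k (Node a) (Leaf y)
  | Node s1 s2 => Node (unelim_tree s1) (unelim_tree s2)
  end.

Lemma elim_treeK : cancel elim_tree unelim_tree.
Proof.
elim=> //= t1 IH1 t2 IH2; case: eqP => [->|_] /=; last by rewrite IH1 IH2.
by case: (elim_tree t2) IH2 => [[k y]|s1 s2] /= <-.
Qed.

Lemma not_lt_min b : B b -> ~ lt b a.
Proof.
case: hB => [[irr tr _] _] Bb ba; case: (a_min Bb) => [h|ab].
  by rewrite h in ba; exact: irr ba.
exact: (irr a Ba (tr _ _ _ Ba Bb Ba ab ba)).
Qed.

Lemma right_not_min b1 b2 : B (Node b1 b2) -> b2 <> a.
Proof.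
by case: hB => _ hN /hN[Bb1 _ + _ _] h; rewrite h; exact: not_lt_min.
Qed.

(** If [b2] is a node, the Hall condition puts its left child at or below [a], hence equal to [a] by
    minimality; so the right children lead through copies of [a] to a single letter. *)
Lemma elim_tree_min b2 : B (Node a b2) -> is_leaf (elim_tree b2).
Proof.
elim: b2 => [x|b1 _ b2 IH] Bb; first by exists (0%N, x).
have [_ Bb12 _ hl _] := hB.2 _ _ Bb.
have b1a : b1 = a.
  case: hl => [[]//|[|//]] /=.
  by move/not_lt_min => h; case: h; have [] := hB.2 _ _ Bb12.
rewrite b1a in Bb12 *; have [[k y] /= ->] := IH Bb12.
by rewrite eqxx; exists (k.+1, y).
Qed.

(** This is the image of [B] without [a]: the second condition says that [s] lies in the range of
    [elim_tree], and the third excludes the image of [a]. *)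
Definition elim_hall : set (Br (nat * X)) :=
  [set s | [/\ B (unelim_tree s), elim_tree (unelim_tree s) = s
             & s <> Leaf (0%N, x0)]].

Definition elim_lt (s s' : Br (nat * X)) := lt (unelim_tree s) (unelim_tree s').

Lemma elim_tree_hall b : B b -> b <> a -> elim_hall (elim_tree b).
Proof.
move=> Bb ba; split; rewrite ?elim_treeK // => h.
by apply: ba; rewrite -[b]elim_treeK h.
Qed.

Lemma elim_hall_like : hall_like elim_hall elim_lt.
Proof.
have [[irr tr tot] hN] := hB; split.
  split=> [s [Bs _ _]|s t u [Bs _ _] [Bt _ _] [Bu _ _]|].
  - exact: irr.
  - exact: tr.
  - move=> s t [Bs es _] [Bt et _] st; apply: tot => // h.
    by apply: st; rewrite -es h et.
move=> s1 s2 [/=Bs es _].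
have [Bs1 Bs2 lt12 hl hlt] := hN _ _ Bs.
have s1a : unelim_tree s1 <> a.
  move=> h; rewrite h in Bs es.
  by have [[k y] ek] := elim_tree_min Bs; rewrite /= eqxx ek in es.
have s2a := right_not_min Bs.
move: es; rewrite /= (introF eqP s1a) => -[es1 es2].
split=> //.
- by split=> // h; apply: s1a; rewrite h.
- by split=> // h; apply: s2a; rewrite h.
- case: s2 {Bs lt12 hlt Bs2 s2a} es2 hl => [p|s3 s4] /=.
    by left; exists p.
  (* [unelim_tree] is not injective, so an equality here does not give [s3 = s1] by itself; it
     follows from [es2], once the left child is known to differ from [a]. *)
  case: (eqVneq (unelim_tree s3) (unelim_tree s1)) => [->|ne].
    by rewrite (introF eqP s1a) es1 => -[->]; right; right.
  by move=> _ [[]//|[|/eqP]]; [right; left|rewrite (negPf ne)].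
Qed.

(** Each occurrence of [a] is a left child and is absorbed into the index [k] of a letter
    [(k, y)]. *)
Lemma leaves_elim_tree b : B b -> b <> a ->
  (leaves (elim_tree b) + count_mem a (fringe b))%N = leaves b.
Proof.
elim: b => [x|b1 IH1 b2 IH2] Bb ba /=; first by rewrite addn0 (introF eqP ba).
have [Bb1 Bb2 _ _ _] := hB.2 _ _ Bb; have b2a := right_not_min Bb.
rewrite count_cat -(IH2 Bb2 b2a); case: eqP => b1a.
  rewrite b1a in Bb *; have [[k y] ->] := elim_tree_min Bb.
  by rewrite /= eqxx addn0 addnCA.
by rewrite -(IH1 Bb1 b1a) /= addnACA.
Qed.

Lemma leaves_elim_tree_le b : B b -> b <> a ->
  (leaves (elim_tree b) + (a \in fringe b) <= leaves b)%N.
Proof.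
move=> Bb ba; rewrite -(leaves_elim_tree Bb ba) leq_add2l -has_pred1 has_count.
by case: (count _ _).
Qed.

(* A pair (k, v) stands for k a + v in the semidirect product, where a acts on
   the free Lie algebra over nat * X by the derivation (j, y) |-> (j.+1, y). *)
Lemma lazard_elimination (K : comNzRingType) :
  exists phi : free_lie K X -> K^o * free_lie K (nat * X),
    [/\ linear phi, phi (ev K a) = (1, 0)
      & forall b, B b -> b <> a -> phi (ev K b) = (0, ev K (elim_tree b))].
Proof.
pose shift (p : nat * X) := free_gen K (p.1.+1, p.2).
pose S := semidirect (der_linear shift) (der_lie shift).
pose f x : S := if Leaf x == a then (1, 0) else (0, free_gen K (0%N, x)).
have [phi [[[phi_lin phi_lie] phi_gen] _]] := free_lie_universal f.
have phia : phi (ev K a) = (1, 0) by rewrite phi_gen /f eqxx.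
exists phi; split=> //; elim=> [x|b1 IH1 b2 IH2] Bb ba.
  by rewrite phi_gen /f (introF eqP ba).
have [Bb1 Bb2 _ _ _] := hB.2 _ _ Bb; have b2a := right_not_min Bb.
rewrite [ev K _]/= phi_lie (IH2 Bb2 b2a) semidirectE /=; case: eqP => b1a.
  rewrite b1a in Bb *; have [[k y] ->] := elim_tree_min Bb.
  rewrite phia /= lie0l add0r scale0r subr0 scale1r.
  by rewrite [der _ _]der_gen.
by rewrite (IH1 Bb1 b1a) /= !scale0r subr0 addr0.
Qed.

End Elimination.

(** * Linear independence of Hall trees *)

Lemma linear_sum_scale (K : comNzRingType) (U V : lmodType K) (phi : U -> V)
    (I : Type) (s : seq I) (k : I -> K) (u : I -> U) : linear phi ->
  phi (\sum_(i <- s) k i *: u i) = \sum_(i <- s) k i *: phi (u i).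
Proof.
move=> phi_lin; elim/big_rec2: _ => [|i v w _ <-]; last exact: phi_lin.
by have := phi_lin (-1) 0 0; rewrite scaler0 addr0 scaleN1r addNr.
Qed.

(** Induction on the total number of leaves in [s]. The alphabet varies along the induction, since
    each elimination replaces [X] by [nat * X]. *)
Theorem hall_like_free (K : comNzRingType) (X : Type) (B : set (Br X)) lt
    (s : seq (Br X)) (alpha : Br X -> K) :
    hall_like B lt -> uniq s -> (forall c, c \in s -> B c) ->
    \sum_(c <- s) alpha c *: ev K c = 0 ->
  forall c, c \in s -> alpha c = 0.
Proof.
have [n] := ubnP (\sum_(c <- s) leaves c).
elim: n X B lt s alpha => // n IH X B lt s alpha lesn hB us sB s0.
pose letters := flatten [seq fringe c | c <- s].
have lettersP u : u \in letters -> exists2 c, c \in s & u \in fringe c.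
  by move/flattenP=> [_ /mapP[c cs ->]]; exists c.
have fringeP c u : c \in s -> u \in fringe c -> u \in letters.
  by move=> cs uc; apply/flattenP; exists (fringe c) => //; exact: map_f.
have [l0|/eqP l0] := eqVneq letters [::].
  move=> c /fringeP fc; have := leaves_gt0 c; rewrite -size_fringe.
  rewrite l0 in fc.
  by case: (fringe c) fc => // u r /(_ u); rewrite mem_head => /(_ isT).
have [a al amin] : exists2 m, m \in letters
    & forall x, x \in letters -> x = m \/ lt m x.
  apply: strict_total_min l0 _; first exact: hB.1.
  by move=> u /lettersP[c /sB Bc]; exact: fringe_hall hB Bc.
have [c0 c0s ac0] := lettersP a al.
have Ba : B a := fringe_hall hB (sB _ c0s) ac0.
have [x0 ax0] := fringe_leaf ac0; rewrite {a}ax0 in al amin ac0 Ba.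
pose a := Leaf x0; pose A := above B lt a.
have hA : hall_like A lt by exact: above_hall_like.
have sA c : c \in s -> A c.
  by move=> cs; split=> [|u uc]; [exact: sB|apply/amin/(fringeP c)].
have Aa : A a by split=> // u; rewrite inE => /eqP; left.
have a_min b : A b -> b = a \/ lt a b by exact: above_min.
have [phi [phi_lin phia phib]] := lazard_elimination hA Aa a_min K.
have := congr1 phi s0; rewrite linear_sum_scale // => phi_s.
have phi0 : phi 0 = 0.
  by have := phi_lin (-1) 0 0; rewrite scaler0 addr0 scaleN1r addNr.
rewrite phi0 in phi_s.
(* In the first component of [phi] only the tree [a] contributes. *)
have alpha_a : a \in s -> alpha a = 0.
  move=> sa; have := congr1 fst phi_s; rewrite raddf_sum /= (bigD1_seq a) //=.
  rewrite phia /= big_seq_cond big1 => [|c /andP[cs /eqP ca]]; last first.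
    by rewrite phib //= ?scaler0 //; exact: sA.
  by rewrite addr0 [_ *: _]mulr1.
move=> c cs; have [ca|/eqP ca] := eqVneq c a.
  by rewrite ca alpha_a // -ca.
pose s' := [seq elim_tree x0 c | c <- s & c != a].
rewrite -(elim_treeK x0 c).
apply: (IH _ (elim_hall A x0) (elim_lt lt x0) s'
  (fun t => alpha (unelim_tree x0 t))).
(* Every tree containing [a] loses a leaf or is [a] itself and is dropped; [c0] is such a tree, so
   the total strictly decreases. *)
- rewrite ltnS in lesn; apply: leq_trans lesn.
  rewrite big_map big_filter big_mkcond -addn1.
  apply: (@leq_trans (\sum_(c <- s)
    ((if c != a then leaves (elim_tree x0 c) else 0) + (a \in fringe c)))%N).
    by rewrite big_split leq_add2l (big_rem c0) //= ac0.
  rewrite big_seq [leqRHS]big_seq; apply: leq_sum => d ds.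
  case: eqP => [->|da] /=; first by case: (a \in _).
  exact: leaves_elim_tree_le hA Aa a_min _ (sA _ ds) da.
- exact: elim_hall_like hA Aa a_min.
- by rewrite map_inj_uniq ?filter_uniq //; exact: can_inj (elim_treeK x0).
- move=> t /mapP[d]; rewrite mem_filter => /andP[/eqP da /sA Ad] ->.
  exact: elim_tree_hall.
(* The second component kills [a] and gives the relation between the eliminated trees. *)
- have := congr1 snd phi_s; rewrite raddf_sum => phi_s2.
  rewrite -[RHS]phi_s2 /=.
  rewrite big_map big_filter [RHS](bigID (pred1 a)) /=.
  rewrite [X in X + _]big1 => [|d /eqP ->].
rewrite add0r big_seq_cond [RHS]big_seq_cond.
    apply: eq_bigr => d.
    case/andP=> ds /eqP da; rewrite elim_treeK phib //; exact: sA.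
  by rewrite phia scaler0.
- by apply: map_f; rewrite mem_filter cs andbT; apply/eqP.
Qed.

(** * Sums of boundedly many trees with signs *)

Section SignedSums.
Variables (K : comNzRingType) (X : Type).
Implicit Types (P Q : Br X -> Prop) (u v : free_lie K X).

(** As [signed_sum0] accepts every [n], the index only bounds the number of terms; trees may repeat
    or cancel. *)
Inductive signed_sum P : nat -> free_lie K X -> Prop :=
| signed_sum0 n : signed_sum P n 0
| signed_sumD n c u : P c -> signed_sum P n u -> signed_sum P n.+1 (ev K c + u)
| signed_sumB n c u : P c -> signed_sum P n u -> signed_sum P n.+1 (u - ev K c).

Lemma signed_sum_ev P n c : P c -> signed_sum P n.+1 (ev K c).
Proof.
by move=> Pc; rewrite -[ev K c]addr0; apply: signed_sumD => //; constructor.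
Qed.

Lemma signed_sum_sub P Q m n u : (m <= n)%N -> (forall c, P c -> Q c) ->
  signed_sum P m u -> signed_sum Q n u.
Proof.
move=> mn PQ su; elim: su n mn => [{}m|{}m c {}u Pc _ IH|{}m c {}u Pc _ IH] n.
- by constructor.
- by case: n => // n mn; apply: signed_sumD; [exact: PQ|exact: IH].
- by case: n => // n mn; apply: signed_sumB; [exact: PQ|exact: IH].
Qed.

Lemma signed_sum_add P m n u v :
  signed_sum P m u -> signed_sum P n v -> signed_sum P (m + n) (u + v).
Proof.
move=> su sv; elim: su => [{}m|{}m c {}u Pc _ IH|{}m c {}u Pc _ IH].
- by rewrite add0r; apply: signed_sum_sub sv => //; exact: leq_addl.
- by rewrite -addrA addSn; apply: signed_sumD.
- by rewrite addrAC addSn; apply: signed_sumB.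
Qed.

Lemma signed_sum_opp P n u : signed_sum P n u -> signed_sum P n (- u).
Proof.
elim=> [{}n|{}n c {}u Pc _ IH|{}n c {}u Pc _ IH].
- by rewrite oppr0; constructor.
- by rewrite opprD addrC; apply: signed_sumB.
- by rewrite opprB; apply: signed_sumD.
Qed.

Lemma signed_sum_bind P Q (f : free_lie K X -> free_lie K X) m n u :
    (forall v w, f (v - w) = f v - f w) ->
    (forall c, P c -> signed_sum Q n (f (ev K c))) ->
  signed_sum P m u -> signed_sum Q (m * n) (f u).
Proof.
move=> fB fP; have f0 : f 0 = 0 by rewrite -[X in f X](subrr 0) fB subrr.
have fN v : f (- v) = - f v by rewrite -[- v]sub0r fB f0 sub0r.
have fD v w : f (v + w) = f v + f w by rewrite -{1}[w]opprK fB fN opprK.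
elim=> [{}m|{}m c {}u Pc _ IH|{}m c {}u Pc _ IH].
- by rewrite f0; constructor.
- by rewrite fD mulSn; apply: signed_sum_add => //; exact: fP.
- by rewrite fB mulSnr; apply: signed_sum_add => //; apply/signed_sum_opp/fP.
Qed.

End SignedSums.

(** * The bracket of two trees of a length-compatible Hall set *)

Section HallBound.
Variables (K : comNzRingType) (X : Type) (B : set (Br X)).
Variables (lt : Br X -> Br X -> Prop).
Hypotheses (hB : hall_set B lt) (hlen : length_compatible B lt).
Implicit Types (a b c m p u v l : Br X) (L : seq (Br X)) (w : free_lie K X).

Definition hall_le a b := lt a b \/ a = b.
(** For [b] and [m] in [B] with [lt m b], this is the remaining condition for [Node m b] to be a
    Hall tree. *)
Definition left_le b m := is_leaf b \/ hall_le (lambda b) m.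

Lemma hall_trans a b c : B a -> B b -> B c -> lt a b -> lt b c -> lt a c.
Proof. by case: hB => -[_ tr _] _ _ _; exact: tr. Qed.

Lemma hall_total a b : B a -> B b -> hall_le a b \/ lt b a.
Proof.
case: hB => -[_ _ tot] _ _ _ Ba Bb; have [->|/eqP ab] := eqVneq a b.
  by left; right.
by have [|] := tot a b Ba Bb ab; [left; left|right].
Qed.

Lemma hall_le_trans a b c : B a -> B b -> B c ->
  hall_le a b -> hall_le b c -> hall_le a c.
Proof.
move=> Ba Bb Bc [ab|->//] [bc|<-]; last by left.
by left; exact: hall_trans ab bc.
Qed.

Lemma hall_lt_leaves a b : B a -> B b -> (leaves a < leaves b)%N -> lt a b.
Proof.
move=> Ba Bb ab; have [[//|ba]|ba] := hall_total Ba Bb.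
  by rewrite ba ltnn in ab.
by have := hlen Bb Ba ba; rewrite leqNgt ab.
Qed.

Lemma hall_node b1 b2 : B b1 -> B b2 -> lt b1 b2 -> left_le b2 b1 ->
  B (Node b1 b2).
Proof. by case: hB => _ _ hN _ *; apply/hN. Qed.

Lemma hall_nodeP b1 b2 : B (Node b1 b2) ->
  [/\ B b1, B b2, lt b1 b2, left_le b2 b1 & lt b1 (Node b1 b2)].
Proof. by move=> Bb; have [] := (hall_set_like hB).2 b1 b2 Bb. Qed.

Lemma hall_lambda b : B b -> B (lambda b).
Proof. exact: hall_like_lambda (hall_set_like hB). Qed.

Lemma left_le_trans b l m : B b -> B l -> B m ->
  left_le b l -> hall_le l m -> left_le b m.
Proof.
move=> Bb Bl Bm [|bl] lm; [by left|right].
exact: hall_le_trans (hall_lambda Bb) Bl Bm bl lm.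
Qed.

(* ad_seq [:: l1; ...; lk] w = [lk, ... [l1, w]] *)
Definition ad_seq L w := foldl (fun w l => lie (ev K l) w) w L.

Lemma ad_seqB L w w' : ad_seq L (w - w') = ad_seq L w - ad_seq L w'.
Proof. by elim: L w w' => //= l L IH w w'; rewrite lieDr lieNr IH. Qed.

Lemma ad_seq0 L : ad_seq L 0 = 0.
Proof. by rewrite -{1}(subrr 0) ad_seqB subrr. Qed.

Lemma ad_seqN L w : ad_seq L (- w) = - ad_seq L w.
Proof. by rewrite -[- w]sub0r ad_seqB ad_seq0 sub0r. Qed.

Lemma ad_seqD L w w' : ad_seq L (w + w') = ad_seq L w + ad_seq L w'.
Proof. by rewrite -{1}[w']opprK ad_seqB ad_seqN opprK. Qed.

(* m <= l1 <= ... <= lk, and each bracket of ad_seq [:: l1; ...; lk] e is a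
   Hall tree when e is a Hall tree with lambda e <= m and more than n leaves. *)
Fixpoint ad_chain m n L : Prop :=
  if L is l :: L' then
    [/\ B l, hall_le m l, (leaves l <= n)%N & ad_chain l (n + leaves l) L']
  else True.

Lemma ad_chain_le l m n L : B l -> B m -> hall_le l m ->
  ad_chain m n L -> ad_chain l n L.
Proof.
case: L => //= l' L Bl Bm lm [Bl' ml' ? ?]; split=> //.
exact: hall_le_trans lm ml'.
Qed.

Definition hall_leaves n c := B c /\ leaves c = n.
Definition sum_leaves L := (\sum_(l <- L) leaves l)%N.

(** Length decides the order: [leaves l <= n < leaves e] puts [l] before [e], and passing to
    [Node l e] adds [leaves l] to both sides of [n < leaves e]. *)
Lemma ad_chain_hall L e m n : B e -> B m -> left_le e m -> ad_chain m n L ->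
  (n < leaves e)%N ->
  exists2 c, hall_leaves (leaves e + sum_leaves L) c
    & ad_seq L (ev K e) = ev K c.
Proof.
rewrite /sum_leaves.
elim: L e m n => [|l L IH] e m n Be Bm em.
  by rewrite big_nil addn0; exists e.
move=> [Bl ml ln chL] ne.
have Ble : B (Node l e).
  apply: hall_node => //; last exact: left_le_trans em ml.
  by apply: hall_lt_leaves => //; exact: leq_ltn_trans ln ne.
have leN : left_le (Node l e) l by right; right.
have lN : (n + leaves l < leaves (Node l e))%N by rewrite addnC ltn_add2l.
have [c hc eq] := IH _ _ _ Ble Bl leN chL lN.
by exists c; rewrite ?big_cons // addnA (addnC (leaves e)).
Qed.

Lemma ad_chain_node L p b m n k : B p -> B b -> B m -> lt p b ->
    left_le b p -> hall_le p m -> ad_chain m n L ->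
    (n < leaves p + leaves b)%N -> (0 < k)%N ->
  signed_sum (hall_leaves (leaves p + leaves b + sum_leaves L)) k
    (ad_seq L (lie (ev K p) (ev K b))).
Proof.
move=> Bp Bb Bm pb bp pm chL ne k0.
have Bpb : B (Node p b) by exact: hall_node.
have pbm : left_le (Node p b) m by right.
have [c hc eq] := ad_chain_hall Bpb Bm pbm chL ne.
by rewrite -[lie _ _]/(ev K (Node p b)) eq -(prednK k0); exact: signed_sum_ev.
Qed.

(* If l < u and l < v, the Leibniz rule moves l into one of the two factors and
   the hypotheses are preserved; otherwise [u, v] is up to sign a Hall tree on
   which all the elements of L act by creating Hall trees. *)
Lemma ad_chain_pair L u v m n : B u -> B v -> B m -> lt m u -> lt m v ->
    left_le u m -> left_le v m -> ad_chain m n L ->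
    (n < leaves u + leaves v)%N ->
  signed_sum (hall_leaves (leaves u + leaves v + sum_leaves L)) (2 ^ size L)
    (ad_seq L (lie (ev K u) (ev K v))).
Proof.
elim: L u v m n => [|l L IH] u v m n Bu Bv Bm.
(* Exchanging [u] and [v] only changes the sign, and the bracket vanishes when they are equal. *)
all: wlog uv : u v Bu Bv / lt u v.
1,3: move=> wuv mu mv um vm chL nuv;
  have [[uv|->]|vu] := hall_total Bu Bv;
    [exact: wuv|by rewrite liexx ad_seq0; exact: signed_sum0|];
  rewrite lieC ad_seqN (addnC (leaves u));
  by apply/signed_sum_opp/wuv => //; rewrite addnC.
  move=> mu mv um vm _ nuv; apply: (@ad_chain_node [::] u v u 0) => //.
  - by apply: left_le_trans vm _ => //; left.
  - by right.
  - by rewrite addn_gt0 leaves_gt0.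
move=> mu mv um vm [Bl ml ln chL] nuv.
have vl := left_le_trans Bv Bm Bl vm ml.
have [ul|lu] := hall_total Bu Bl.
  apply: (@ad_chain_node (l :: L) u v u n) => //.
  - by apply: left_le_trans vm _ => //; left.
  - by right.
  - by rewrite expn_gt0.
have lv : lt l v by exact: hall_trans lu uv.
have ul := left_le_trans Bu Bm Bl um ml.
have Blu : B (Node l u) by exact: hall_node.
have Blv : B (Node l v) by exact: hall_node.
have [_ _ _ _ llu] := hall_nodeP Blu; have [_ _ _ _ llv] := hall_nodeP Blv.
rewrite /= lie_leibniz ad_seqD expnS mul2n -addnn; apply: signed_sum_add.
  apply: signed_sum_sub (leqnn _) _
    (IH (Node l u) v l (n + leaves l)%N Blu Bv Bl llu lv _ vl chL _) => /=.
  - by rewrite /sum_leaves big_cons => c [? lc]; split=> //; rewrite lc /=; lia.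
  - by right; right.
  - lia.
apply: signed_sum_sub (leqnn _) _
  (IH u (Node l v) l (n + leaves l)%N Bu Blv Bl lu llv ul _ chL _) => /=.
- by rewrite /sum_leaves big_cons => c [? lc]; split=> //; rewrite lc /=; lia.
- by right; right.
- lia.
Qed.

(** The two summands on the left count the two Leibniz terms for $b = (l, r)$, with $i = |l|$ and $j
    = |r|$. For $x = 2^{i-1}$ and $y = 2^{j-1}$ the inequality amounts to $(x-1)(2y-1) \geq 0$. *)
Lemma pow2_step k i j : (0 < i)%N -> (0 < j)%N ->
  (2 ^ i.-1 * 2 ^ k + (2 ^ k.+1 * (2 ^ j.-1 - 1) + 1)
    <= 2 ^ k * (2 ^ (i + j).-1 - 1) + 1)%N.
Proof.
case: i j => // i [|j] // _ _; rewrite /= addnS expnD !expnS /=.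
have := expn_gt0 2 i; have := expn_gt0 2 j; have := expn_gt0 2 k.
move: (2 ^ i)%N (2 ^ j)%N (2 ^ k)%N => x y z.
case: x => // x; case: y => // y _ _ _.
rewrite subn1 /=.
have -> : (x.+1 * (2 * y.+1) - 1 = 2 * (x * y) + 2 * x + 2 * y + 1)%N by lia.
rewrite !mulnDr; nia.
Qed.

Lemma ad_chain_bracket L p b m : B p -> B b -> B m -> lt p b -> hall_le p m ->
    left_le b m -> ad_chain m (leaves b) L ->
  signed_sum (hall_leaves (leaves p + leaves b + sum_leaves L))
    (2 ^ size L * (2 ^ (leaves b).-1 - 1) + 1)
    (ad_seq L (lie (ev K p) (ev K b))).
Proof.
have [n] := ubnP (leaves b).
elim: n b p m L => // n IH b p m L lebn Bp Bb Bm pb pm bm chL.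
(* Either $(p, b')$ is already a Hall tree, or $b'$ splits with $p$ below its left factor. This is
   used for [b] and again for [l]. *)
have base b' : B b' -> lt p b' -> left_le b' p \/
    exists l r, [/\ b' = Node l r, B l & lt p l].
  case: b' => [x|l r] Bb' pb'; first by left; left; exists x.
  have [Bl _ _ _ _] := hall_nodeP Bb'.
  by have [lp|pl] := hall_total Bl Bp; [left; right|right; exists l, r].
case: (base b Bb pb) => [bp|[l [r [eb Bl pl]]]].
  apply: (ad_chain_node (m := m) (n := leaves b)) => //; last by rewrite addn1.
  by rewrite -[X in (X < _)%N]add0n ltn_add2r leaves_gt0.
rewrite {b}eb in lebn Bb pb bm chL *.
have [_ Br lr rl lN] := hall_nodeP Bb; rewrite /= in lebn chL *.
have lm : hall_le l m by case: bm => [[]|].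
have lrn : (leaves l <= leaves r)%N by exact: hlen.
have pln : (leaves p <= leaves l)%N by exact: hlen.
have l0 := leaves_gt0 l; have r0 := leaves_gt0 r; have p0 := leaves_gt0 p.
have pr : lt p r by exact: hall_trans pl lr.
have chlL := ad_chain_le Bl Bm lm chL.
rewrite lie_leibniz ad_seqD.
apply: signed_sum_sub (pow2_step (size L) l0 r0) _ _.
  by move=> c; exact.
apply: signed_sum_add; last first.
  (* The term $[l, [p, r]]$ is the same statement for [r], with [l] put in front of the chain. *)
  apply: signed_sum_sub (leqnn _) _ (IH r p l (l :: L) _ Bp Br Bl pr _ rl _).
  - by rewrite /sum_leaves big_cons => c [? lc]; split=> //; rewrite lc /=; lia.
  - lia.
  - by left.
  - by rewrite addnC in chlL; split=> //; right.
pose P c := hall_leaves (leaves p + leaves l) c /\ left_le c l.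
have plP : signed_sum P (2 ^ (leaves l).-1) (lie (ev K p) (ev K l)).
  case: (base l Bl pl) => [lp|[l1 [l2 [el Bl1 pl1]]]].
    rewrite -(@prednK (2 ^ _)) ?expn_gt0 //.
    apply: (@signed_sum_ev K X P _ (Node p l)); split; last by right; left.
    by split=> //; exact: hall_node.
  have ll : left_le l l.
    by right; left; rewrite el in Bl *; have [] := hall_nodeP Bl.
  have pl' : (leaves p < leaves l)%N.
    have l20 := leaves_gt0 l2; have := hlen Bp Bl1 pl1; rewrite el /=; lia.
  have lel : (leaves l < n)%N by lia.
  apply: signed_sum_sub _ _ (IH l p l [::] lel Bp Bl Bl pl (or_introl pl) ll I).
    by rewrite mul1n; have := expn_gt0 2 (leaves l).-1; lia.
  rewrite /sum_leaves big_nil addn0 => c [Bc lc]; split=> //.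
  case: c Bc lc => [x|c1 c2] Bc lc; first by left; exists x.
  (* Here $2|c_1| \leq |c_1| + |c_2| = |p| + |l| < 2|l|$, so [c1] is shorter than [l] and precedes
     it. *)
  have [Bc1 Bc2 lt12 _ _] := hall_nodeP Bc; have lc12 := hlen Bc1 Bc2 lt12.
  by rewrite /= in lc; right; left; apply: hall_lt_leaves => //=; lia.
apply: (signed_sum_bind (f := fun w => ad_seq L (lie w (ev K r)))) plP.
  by move=> v w; rewrite lieDl lieNl ad_seqB.
move=> c [[Bc lc] cl].
have lc' : lt l c by apply: hall_lt_leaves => //; lia.
have n_lt : (leaves l + leaves r < leaves c + leaves r)%N by lia.
apply: signed_sum_sub (leqnn _) _
  (ad_chain_pair Bc Br Bl lc' lr cl rl chlL n_lt).
by move=> d [? ld]; split=> //; rewrite ld lc; lia.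
Qed.

Lemma hall_bracket_bound a b : B a -> B b -> lt a b ->
  signed_sum B (2 ^ (leaves b - 1)) (lie (ev K a) (ev K b)).
Proof.
move=> Ba Bb ab; have bb : left_le b b.
  case: b Bb {ab} => [x|l r] Bb; first by left; exists x.
  by right; left; have [] := hall_nodeP Bb.
(* With an empty chain, [m] only has to dominate [a] and the left factor of [b], so [b] itself
   serves. *)
apply: signed_sum_sub _ _
  (@ad_chain_bracket [::] a b b Ba Bb Bb ab (or_introl ab) bb I).
  by rewrite mul1n subn1; have := expn_gt0 2 (leaves b).-1; lia.
by move=> c [].
Qed.
End HallBound.

(** * From signed sums to the norm *)

Section HallNormBound.
Variables (K : numFieldType) (X : Type) (B : set (Br X)).
Variables (lt : Br X -> Br X -> Prop).
Hypothesis hB : hall_set B lt.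

Lemma finsupp_sum_incl (V : zmodType) (alpha : {fsfun Br X -> K with 0})
    (S : {fset Br X}) (F : Br X -> K -> V) : (finsupp alpha `<=` S)%fset ->
    (forall c, F c 0 = 0) ->
  \sum_(c <- finsupp alpha) F c (alpha c) = \sum_(c <- S) F c (alpha c).
Proof.
by move=> aS F0; apply: big_fset_incl => // c _ /fsfun_dflt ->; exact: F0.
Qed.

Lemma hall_decomposition_unique (u : free_lie K X) alpha beta :
  hall_decomposition B u alpha -> hall_decomposition B u beta -> alpha = beta.
Proof.
move=> [aB ua] [bB ub].
pose S := (finsupp alpha `|` finsupp beta)%fset.
have scale0 (c : Br X) : 0 *: ev K c = 0 by exact: scale0r.
have aS : (finsupp alpha `<=` S)%fset by exact: fsubsetUl.
have bS : (finsupp beta `<=` S)%fset by exact: fsubsetUr.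
have sum0 : \sum_(c <- S) (alpha c - beta c) *: ev K c = 0.
  under eq_bigr do rewrite scalerBl.
  rewrite (finsupp_sum_incl (F := fun c k => k *: ev K c) aS scale0) in ua.
  rewrite (finsupp_sum_incl (F := fun c k => k *: ev K c) bS scale0) in ub.
  by rewrite sumrB -ua -ub subrr.
apply/fsfunP => c; have [cS|] := boolP (c \in S).
  apply/eqP; rewrite -subr_eq0; apply/eqP.
  apply: (hall_like_free (alpha := fun c => alpha c - beta c) (hall_set_like hB)
    (fset_uniq S) _ sum0 cS) => d.
  by rewrite inE => /orP[/aB|/bB].
by rewrite inE negb_or => /andP[/fsfun_dflt -> /fsfun_dflt ->].
Qed.

Lemma hall_normE (u : free_lie K X) alpha : hall_decomposition B u alpha ->
  hall_norm B u = \sum_(c <- finsupp alpha) `|alpha c|.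
Proof.
move=> ua; rewrite /hall_norm; suff -> : hall_coord B u = alpha by [].
apply: (hall_decomposition_unique _ ua).
exact: (@xgetPex _ [fsfun] (hall_decomposition B u) (ex_intro _ alpha ua)).
Qed.

(** Only the coefficient at [c] changes, and the triangle inequality bounds its growth. *)
Lemma hall_decompositionD (u : free_lie K X) alpha c (e : K) : B c ->
    hall_decomposition B u alpha ->
  exists2 beta, hall_decomposition B (e *: ev K c + u) beta
    & \sum_(d <- finsupp beta) `|beta d| <=
      `|e| + \sum_(d <- finsupp alpha) `|alpha d|.
Proof.
move=> Bc [aB ->]; pose beta := [fsfun alpha with c |-> e + alpha c].
(* The tree [c] may be missing from the support of [alpha], or from that of [beta] after
   cancellation, so both sums are taken over [S]. *)
pose S := (c |` finsupp alpha)%fset.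
have cS : c \in S by rewrite !inE eqxx.
have bS : (finsupp beta `<=` S)%fset.
  apply/fsubsetP => d; rewrite mem_finsupp fsfun_withE in_fset1U.
  by case: (d == c) => //=; rewrite -mem_finsupp.
have betac : beta c = e + alpha c by rewrite fsfun_with.
have betad d : d \in (S `\ c)%fset -> beta d = alpha d.
  by rewrite !inE => /andP[/negPf dc _]; rewrite fsfun_withE dc.
exists beta.
  split=> [d /(fsubsetP bS)|]; first by rewrite !inE => /orP[/eqP ->|/aB].
  rewrite (finsupp_sum_incl (F := fun c k => k *: ev K c) bS); last first.
    by move=> d; rewrite scale0r.
  rewrite (finsupp_sum_incl (F := fun c k => k *: ev K c) (fsubsetU1 c _));
    last first.
    by move=> d; rewrite scale0r.
  rewrite !(big_fsetD1 c cS) /= betac addrA -scalerDl; congr (_ + _).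
  by rewrite big_seq [RHS]big_seq; apply: eq_bigr => d /betad ->.
rewrite (finsupp_sum_incl (F := fun=> Num.norm) bS); last first.
  by move=> _; rewrite normr0.
rewrite (finsupp_sum_incl (F := fun=> Num.norm) (fsubsetU1 c _)); last first.
  by move=> _; rewrite normr0.
rewrite !(big_fsetD1 c cS) /= betac addrA lerD ?ler_normD //.
by rewrite big_seq [leRHS]big_seq; apply: ler_sum => d /betad ->.
Qed.

Lemma signed_sum_decomposition n (u : free_lie K X) : signed_sum B n u ->
  exists2 alpha, hall_decomposition B u alpha
    & \sum_(c <- finsupp alpha) `|alpha c| <= n%:R.
Proof.
elim=> [{}n|{}n c {}u Bc _ [alpha ua an]|{}n c {}u Bc _ [alpha ua an]].
- exists [fsfun]; last by rewrite finsupp0 big_nil ler0n.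
  by split=> [c|]; rewrite finsupp0 ?big_nil.
- have [beta ub bn] := hall_decompositionD 1 Bc ua.
  exists beta; first by rewrite scale1r in ub.
  by apply: le_trans bn _; rewrite normr1 -natr1 addrC lerD2r.
- have [beta ub bn] := hall_decompositionD (-1) Bc ua.
  exists beta; first by rewrite scaleN1r addrC in ub.
  by apply: le_trans bn _; rewrite normrN1 -natr1 addrC lerD2r.
Qed.

Lemma hall_norm_signed_sum n (u : free_lie K X) :
  signed_sum B n u -> hall_norm B u <= n%:R.
Proof. by move=> /signed_sum_decomposition[alpha /hall_normE ->]. Qed.

End HallNormBound.

Theorem theorem1p5 (R : realType) (K : numFieldType)
    (hK : real_or_complex R K) (X : Type)
    (hX : exists x y : X, x <> y)
    (B : set (Br X)) (lt : Br X -> Br X -> Prop)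
    (hB : hall_set B lt) (hlen : length_compatible B lt) :
  forall a b : Br X, B a -> B b -> lt a b ->
    hall_norm B (lie (ev K a) (ev K b)) <= 2 ^+ (leaves b - 1)%N.
Proof.
move=> a b Ba Bb ab; rewrite -natrX.
apply: (hall_norm_signed_sum hB).
exact: hall_bracket_bound hB hlen a b Ba Bb ab.
Qed.
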